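(* Let $\Delta$ be a division ring, $n\in\mathbb{N}$, and let $E\in M_n(\Delta)$ be idempotent. Let $A\in M_n(\Delta)$ be an invertible matrix such that $$E=A\begin{pmatrix} I_{\operatorname{rank}(E)} & O\\ O& O\end{pmatrix}A^{-1}.$$ Then for every idempotent $F\in M_n(\Delta)$ we have $E\le F$ if and only if $$F=A\begin{pmatrix} I_{\operatorname{rank}(E)} & O\\ O& T\end{pmatrix}A^{-1}$$ for some idempotent matrix $T\in M_{n-\operatorname{rank}(E)}(\Delta)$. In particular, if $E\le F$ then $\operatorname{rank}(E)\le \operatorname{rank}(F)$.
   Context: For idempotents $e,f$ in a ring, $e\le f$ means $ef=e=fe$; this is a partial order on the set of idempotents. The rank of a matrix in $M_n(\Delta)$ is the dimension of its column space (the right $\Delta$-subspace of $\Delta^n$ spanned by its columns). $I_\ell$ denotes the $\ell\times\ell$ identity matrix and $O$ a zero block of the appropriate size. Blocks of size $0$ are allowed and are empty. *)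

(* Defs.v *)
From HB Require Import structures.
From mathcomp Require Import all_boot all_order all_algebra.
From mathcomp Require Import boolp classical_sets.
Set Implicit Arguments.
Unset Strict Implicit.
Unset Printing Implicit Defensive.
Import GRing.Theory.
Local Open Scope ring_scope.

Definition idempotent_elt (R : pzRingType) (e : R) : Prop := e * e = e.

(* The order on idempotents; only meaningful when e and f are idempotent. *)
Definition idem_le (R : pzRingType) (e f : R) : Prop := e * f = e /\ f * e = e.

(* MathComp's \rank and unitmx need commutative scalars, so the notions below
   are set up for a possibly noncommutative ring R.  A family of r vectors of
   R^n is stored as the columns of B : 'M[R]_(n, r); for c : 'cV[R]_r, the
   vector B *m c is then the right linear combination
   \sum_j (col j B) * (c j). *)
Section RightDimension.
Variables (R : nzRingType) (n : nat).

Definition col_space (r : nat) (B : 'M[R]_(n, r)) : set 'cV[R]_n :=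
  [set v | exists c : 'cV[R]_r, v = B *m c]%classic.

Definition right_free (r : nat) (B : 'M[R]_(n, r)) : Prop :=
  forall c : 'cV[R]_r, B *m c = 0 -> c = 0.

Definition right_basis (V : set 'cV[R]_n) (r : nat) (B : 'M[R]_(n, r)) : Prop :=
  right_free B /\ col_space B = V.

(* The number of elements of a basis of V, and 0 if V has no finite basis.
   Over a division ring the column space of a matrix has a finite basis
   (col_space_has_basis) and all its bases have the same size
   (right_basis_size). *)
Definition right_dim (V : set 'cV[R]_n) : nat :=
  xget 0%N [set r | exists B : 'M[R]_(n, r), right_basis V B]%classic.

Definition col_rank (m : nat) (A : 'M[R]_(n, m)) : nat :=
  right_dim (col_space A).

End RightDimension.

(* GRing.field_axiom says that nonzero elements are units; as a unitRingType is
   nontrivial but not necessarily commutative, it makes D a division ring. *)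
Section DivisionRing.
Variables (D : unitRingType) (divD : GRing.field_axiom D).

Lemma wide_kernel (m n : nat) (A : 'M[D]_(m, n)) :
  (m < n)%N -> exists2 c : 'cV[D]_n, A *m c = 0 & c != 0.
Proof.
elim: m n A => [|m IHm] [|n] // A lt_mn.
  exists (const_mx 1); first by apply/matrixP => -[].
  by apply/eqP => /matrixP/(_ ord0 ord0)/eqP; rewrite !mxE oner_eq0.
have [j Aj|A0] := pickP (fun j => A ord0 j != 0).
  pose P : 'M[D]_(n.+1, n) := \matrix_(i, k)
    ((i == lift j k)%:R - (i == j)%:R * ((A ord0 j)^-1 * A ord0 (lift j k))).
  have PE i c l : (P *m c) (lift j i) l = c i l.
    rewrite mxE (bigD1 i) //= big1 ?addr0 => [|k ki]; rewrite !mxE.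
      by rewrite eqxx eq_sym (negbTE (neq_lift _ _)) mul0r subr0 mul1r.
    rewrite (inj_eq lift_inj) eq_sym (negbTE ki) eq_sym.
    by rewrite (negbTE (neq_lift _ _)) mul0r subr0 mul0r.
  have AP0 k : (A *m P) ord0 k = 0.
    rewrite mxE; under eq_bigr do rewrite mxE mulrBr.
    rewrite sumrB (bigD1 (lift j k)) //= eqxx mulr1 big1 ?addr0; last first.
      by move=> i /negbTE->; rewrite mulr0.
    rewrite (bigD1 j) //= eqxx mul1r mulVKr ?divD // big1 ?addr0 ?subrr //.
    by move=> i /negbTE->; rewrite mul0r mulr0.
  have [c Ac c0] := IHm n (\matrix_(i, k) (A *m P) (lift ord0 i) k) lt_mn.
  exists (P *m c).
    apply/matrixP => i l; rewrite mulmxA [RHS]mxE.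
    have [i' ->|->] := unliftP ord0 i.
      have /matrixP/(_ i' l) := Ac; rewrite [RHS]mxE; apply: etrans.
      by rewrite [LHS]mxE [RHS]mxE; apply: eq_bigr => k _; rewrite [in RHS]mxE.
    by rewrite mxE big1 // => k _; rewrite AP0 mul0r.
  apply: contraNneq c0 => Pc0; apply/eqP/matrixP => i l.
  by rewrite -PE Pc0 !mxE.
have [c Ac c0] := IHm n.+1 (\matrix_(i, k) A (lift ord0 i) k) (ltnW lt_mn).
exists c => //; apply/matrixP => i l; rewrite [RHS]mxE.
have [i' ->|->] := unliftP ord0 i.
  have /matrixP/(_ i' l) := Ac; rewrite [RHS]mxE; apply: etrans.
  by rewrite [LHS]mxE [RHS]mxE; apply: eq_bigr => k _; rewrite [in RHS]mxE.
rewrite mxE big1 // => k _; move/negbFE/eqP: (A0 k) => ->.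
by rewrite mul0r.
Qed.

Lemma right_free_leq (n r s : nat) (B : 'M[D]_(n, r)) (C : 'M[D]_(n, s)) :
  right_free B -> (forall j, col_space C (col j B)) -> (r <= s)%N.
Proof.
move=> freeB /choice[f fP]; rewrite leqNgt; apply/negP => lt_sr.
have BE : B = C *m (\matrix_(i, j) f j i 0).
  apply/matrixP => i j; move/matrixP/(_ i 0): (fP j); rewrite !mxE => ->.
  by apply: eq_bigr => k _; rewrite mxE.
have [c Kc0] := wide_kernel (\matrix_(i, j) f j i 0) lt_sr.
by rewrite [c]freeB ?eqxx // BE -mulmxA Kc0 mulmx0.
Qed.

Lemma right_free_leq_dim (n r : nat) (B : 'M[D]_(n, r)) :
  right_free B -> (r <= n)%N.
Proof.
move=> freeB; apply: (right_free_leq (C := 1%:M) freeB) => j.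
by exists (col j B); rewrite mul1mx.
Qed.

Lemma col_space_col (n r : nat) (B : 'M[D]_(n, r)) j : col_space B (col j B).
Proof. by exists (delta_mx j 0); rewrite colE. Qed.

Lemma right_basis_size (n r s : nat) (V : set 'cV[D]_n)
    (B : 'M[D]_(n, r)) (C : 'M[D]_(n, s)) :
  right_basis V B -> right_basis V C -> r = s.
Proof.
move=> [freeB BV] [freeC CV]; apply/eqP; rewrite eqn_leq.
apply/andP; split.
  by apply: (right_free_leq (C := C) freeB) => j; rewrite CV -BV; apply: col_space_col.
by apply: (right_free_leq (C := B) freeC) => j; rewrite BV -CV; apply: col_space_col.
Qed.

Lemma col_space_has_basis (n m : nat) (A : 'M[D]_(n, m)) :
  exists r (B : 'M[D]_(n, r)), right_basis (col_space A) B.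
Proof.
pose P r := `[< exists2 B : 'M[D]_(n, r),
  right_free B & forall j, col_space A (col j B) >].
have exP : exists r, P r.
  exists 0%N; apply/asboolP; exists 0 => [c _|[]//].
  by apply/matrixP => -[].
have ubP r : P r -> (r <= n)%N.
  by move=> /asboolP[B /right_free_leq_dim].
case: (ex_maxnP exP ubP) => r /asboolP[B freeB BA] maxr.
exists r, B; split => //; apply/seteqP; split => v.
  move=> [c ->]; have [f fP] := choice BA.
  exists ((\matrix_(i, j) f j i 0) *m c); rewrite mulmxA; congr (_ *m _).
  apply/matrixP => i j; move/matrixP/(_ i 0): (fP j); rewrite !mxE => ->.
  by apply: eq_bigr => k _; rewrite mxE.
move=> Av; apply: contrapT => Bv.
suff /maxr : P (r + 1)%N by rewrite addn1 ltnn.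
apply/asboolP; exists (row_mx B v) => [c|j]; last first.
  by rewrite -(splitK j); case: (split j) => k /=;
    rewrite ?colKl ?colKr // (ord1 k) col_id.
rewrite -[c]vsubmxK mul_row_col.
rewrite [dsubmx c]mx11_scalar; set c1 := usubmx c; set a := dsubmx c 0 0 => Ec.
have [a0|/divD Ua] := eqVneq a 0.
  move: Ec; rewrite a0 raddf0 mulmx0 addr0 => /freeB->.
  by rewrite col_mx0.
case: Bv; exists (c1 *m - a^-1%:M).
rewrite mulmxA; move/eqP: Ec; rewrite addr_eq0 => /eqP->.
by rewrite mulNmx mulmxN opprK -mulmxA -scalar_mxM divrr // mulmx1.
Qed.

Lemma right_dimE (n r : nat) (V : set 'cV[D]_n) (B : 'M[D]_(n, r)) :
  right_basis V B -> right_dim V = r.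
Proof.
move=> VB; apply: xget_unique; first by exists B.
by move=> s [C VC]; apply: right_basis_size VC VB.
Qed.

Lemma col_rank_leq (n m : nat) (A : 'M[D]_(n, m)) : (col_rank A <= n)%N.
Proof.
have [r [B BA]] := col_space_has_basis A.
by rewrite /col_rank (right_dimE BA); apply: right_free_leq_dim BA.1.
Qed.

End DivisionRing.

(* The block matrix ( I_r O ; O T ) of size r + (n - r), cast to size n. *)
Definition id_block (R : nzRingType) (r n : nat) (le_rn : (r <= n)%N)
    (T : 'M[R]_(n - r)) : 'M[R]_n :=
  castmx (subnKC le_rn, subnKC le_rn) (block_mx (1%:M : 'M[R]_r) 0 0 T).

(* Main.v *)
Require Import Defs.
From mathcomp Require Import all_boot all_order all_algebra.
Import GRing.Theory.
Local Open Scope ring_scope.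

(** Conjugation by [A] is a ring automorphism of the matrix ring, so it
    preserves idempotents and their order and one may assume that
    [E = diag (I, 0)].  For an element [G] with blocks [P Q; R S], the equations
    [E * G = E = G * E] say that [(P Q; 0 0) = diag (I, 0) = (P 0; R 0)], that
    is, [G = diag (I, S)] ([ge_id_block0]).  As [diag (I, -)] is multiplicative
    and injective ([id_block_mul], [id_block_inj]), [G] is idempotent exactly
    when [S] is, and conversely every [diag (I, T)] lies above [E].

    The inequality of ranks comes directly from [E = F * E], which puts the column
    space of [E] inside that of [F], and a free family lying in the span
    of another family has at most as many members ([col_rank_mulmx]). *)

(** The sizes [m] and [n] are independent variables so that [e] can be
    eliminated; in [r + (n - r) = n] the variable [n] occurs on both sides. *)
Lemma castmx_mulmx (R : pzRingType) (m n : nat) (e : m = n) (X Y : 'M[R]_m) :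
  castmx (e, e) (X *m Y) = castmx (e, e) X *m castmx (e, e) Y.
Proof. by case: n / e; rewrite !castmx_id. Qed.

Lemma castmx_inj (R : Type) (m n m' n' : nat) (e : (m = m') * (n = n')) :
  injective (@castmx R m n m' n' e).
Proof. by case: e => em en; apply: (can_inj (castmxK em en)). Qed.

Section IdBlock.
Variables (R : nzRingType) (r n : nat) (le_rn : (r <= n)%N).
Implicit Types S T : 'M[R]_(n - r).

Lemma id_block_mul S T :
  id_block le_rn S *m id_block le_rn T = id_block le_rn (S *m T).
Proof.
rewrite /id_block -castmx_mulmx mulmx_block.
by rewrite !(mulmx0, mul0mx, mulmx1, addr0, add0r).
Qed.

Lemma id_block_inj S T : id_block le_rn S = id_block le_rn T -> S = T.
Proof. by move/castmx_inj/eq_block_mx => []. Qed.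

(** The two equations fix three of the four blocks of [G] and leave the lower
    right one free. *)
Lemma ge_id_block0 (G : 'M[R]_n) :
  id_block le_rn 0 *m G = id_block le_rn 0 ->
  G *m id_block le_rn 0 = id_block le_rn 0 ->
  exists T, G = id_block le_rn T.
Proof.
pose e := subnKC le_rn.
have -> : G = castmx (e, e) (castmx (esym e, esym e) G) by rewrite castmxKV.
rewrite /id_block -/e; move: (castmx (esym e, esym e) G) => H.
rewrite -!castmx_mulmx -[H]submxK !mulmx_block.
rewrite !(mulmx0, mul0mx, mulmx1, mul1mx, addr0, add0r).
move=> /castmx_inj/eq_block_mx[-> -> _ _].
move=> /castmx_inj/eq_block_mx[_ _ -> _].
by exists (drsubmx H).
Qed.

End IdBlock.

Section Conjugation.
Variables (R : pzRingType) (n : nat) (A invA : 'M[R]_n).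
Hypothesis (invAA : invA *m A = 1%:M).

Lemma conjmx_mul (X Y : 'M[R]_n) :
  (A *m X *m invA) *m (A *m Y *m invA) = A *m (X *m Y) *m invA.
Proof. by rewrite !mulmxA -(mulmxA _ invA A) invAA mulmx1. Qed.

Lemma conjmxK (X : 'M[R]_n) : invA *m (A *m X *m invA) *m A = X.
Proof. by rewrite !mulmxA invAA mul1mx -mulmxA invAA mulmx1. Qed.

Lemma conjmx_inj (X Y : 'M[R]_n) :
  A *m X *m invA = A *m Y *m invA -> X = Y.
Proof. by move=> eqXY; rewrite -[X]conjmxK eqXY conjmxK. Qed.

End Conjugation.

Lemma col_rank_mulmx (D : unitRingType) (divD : GRing.field_axiom D)
    (n m p : nat) (F : 'M[D]_(n, m)) (X : 'M[D]_(m, p)) :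
  (col_rank (F *m X) <= col_rank F)%N.
Proof.
have [r [B basB]] := col_space_has_basis divD (F *m X).
have [s [C basC]] := col_space_has_basis divD F.
rewrite /col_rank (right_dimE divD basB) (right_dimE divD basC).
have [[freeB spanB] [_ spanC]] := (basB, basC).
apply: (right_free_leq divD (C := C) freeB) => j; rewrite spanC.
have : col_space B (col j B) by apply: col_space_col.
by rewrite spanB => -[c ->]; exists (X *m c); rewrite mulmxA.
Qed.

Theorem theorem2p4 (D : unitRingType) (divD : GRing.field_axiom D) (n : nat)
    (E : 'M[D]_n) (idemE : idempotent_elt E)
    (A invA : 'M[D]_n) (AinvA : A *m invA = 1%:M) (invAA : invA *m A = 1%:M)
    (defE : E = A *m id_block (col_rank_leq divD E) 0 *m invA) :
  (forall F : 'M[D]_n, idempotent_elt F ->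
     (idem_le E F <->
      exists T : 'M[D]_(n - col_rank E), idempotent_elt T /\
        F = A *m id_block (col_rank_leq divD E) T *m invA))
  /\
  (forall F : 'M[D]_n, idempotent_elt F ->
     idem_le E F -> (col_rank E <= col_rank F)%N).
Proof.
split=> F idemF; last by case=> _ <-; apply: col_rank_mulmx.
(* The rank of [E] and its bound occur on the right of [defE]: with an arbitrary
   [r] in their place, [E] becomes a variable that can be eliminated. *)
move: (col_rank E) (col_rank_leq divD E) defE => r le_rn {idemE}->.
have [G defF] : exists G, F = A *m G *m invA.
  by exists (invA *m F *m A); rewrite (conjmxK _ _ _ _ AinvA).
move: idemF; rewrite {F}defF /idempotent_elt /idem_le -!mulmxE.
rewrite !(conjmx_mul _ _ _ _ invAA) => /(conjmx_inj _ _ _ _ invAA) idemG.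
split=> [[/(conjmx_inj _ _ _ _ invAA) EG /(conjmx_inj _ _ _ _ invAA) GE]|].
  have [T defG] := ge_id_block0 _ _ _ _ _ EG GE; exists T; rewrite defG; split=> //.
  by move: idemG; rewrite defG id_block_mul => /id_block_inj.
by case=> T [_ /(conjmx_inj _ _ _ _ invAA) ->]; rewrite !id_block_mul mul0mx mulmx0.
Qed.
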